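(* Let $n\ge 2$ and let $\sim$ be the relation on the set $\mathcal F_n$ of $n$PC formulas given by $F\sim G$ iff for all $i\in\{1,\dots,n\}$ both $F\vdash_i G$ and $G\vdash_i F$ are provable in $n$PC. Then $\mathcal F_n/\!\sim$, equipped with the operation $q([F_0],[F_1],\dots,[F_n])=[q(F_0,F_1,\dots,F_n)]$ and the constants $[\mathsf e_1],\dots,[\mathsf e_n]$, is a Boolean-like algebra of dimension $n$ (the Lindenbaum algebra $L_n$ of $n$PC).
   Context: Fix $n\ge 2$, write $\hat n=\{1,\dots,n\}$, let $S_n$ be the group of permutations of $\hat n$ and $V$ a countable set of propositional variables. Formulas of $n$PC are: decorated variables $X^\pi$ ($X\in V$, $\pi\in S_n$); constants $\mathsf e_1,\dots,\mathsf e_n$; compound formulas $q(F,G_1,\dots,G_n)$. For $\rho\in S_n$, $F^\rho$ is defined by $(X^\pi)^\rho=X^{\rho\circ\pi}$, $(\mathsf e_k)^\rho=\mathsf e_{\rho(k)}$, $q(F,G_1,\dots,G_n)^\rho=q(F,G_1^\rho,\dots,G_n^\rho)$. $(ij)$ denotes the transposition exchanging $i$ and $j$ (identity if $i=j$). Contexts $\Gamma,\Delta$ are finite multisets of formulas, $\Gamma^\rho$ elementwise. Sequents $\Gamma\vdash_i\Delta$ ($i\in\hat n$) are provable if derivable by the rules (premises $\Rightarrow$ conclusion), for all $i,j,k\in\hat n$: (Const) $\Rightarrow\ \vdash_i\mathsf e_i$. (Id) $\Rightarrow X^\pi\vdash_i X^\rho$ whenever $\pi^{-1}(i)=\rho^{-1}(i)$.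 (Sym) $\Gamma^{(ij)}\vdash_i\Delta^{(ij)}\Rightarrow\Gamma\vdash_j\Delta$. (Neg1) if $i\ne k$: $\Gamma^{(ij)}\vdash_i F,\Delta^{(ij)}\Rightarrow \Gamma,F^{(jk)}\vdash_j\Delta$. (Neg2) if $j\neq k$: $\Gamma^{(ij)}\vdash_i F,\Delta^{(ij)}\Rightarrow \Gamma,F^{(ik)}\vdash_j\Delta$. (Neg3) $\{\Gamma^{(ij)},F\vdash_i\Delta^{(ij)}\}_{i\neq j}\Rightarrow\Gamma\vdash_j F,\Delta$. (qL) $\{\Gamma^{(ji)},F,G_j^{(ji)}\vdash_j\Delta^{(ji)}\}_{j\in\hat n}\Rightarrow \Gamma,q(F,G_1,\dots,G_n)\vdash_i\Delta$. (qR) $\{\Gamma^{(ji)},F\vdash_j G_j^{(ji)},\Delta^{(ji)}\}_{j\in\hat n}\Rightarrow\Gamma\vdash_i q(F,G_1,\dots,G_n),\Delta$. (Cut) $\Gamma,F\vdash_i\Delta$ and $\Gamma\vdash_i F,\Delta\Rightarrow\Gamma\vdash_i\Delta$. Left and right weakening and contraction in each $\vdash_i$. A Boolean-like algebra of dimension $n$ (in the pure type $(q,\mathsf e_1,\dots,\mathsf e_n)$, $q$ of arity $n+1$) is an algebra $(A,q,\mathsf e_1,\dots,\mathsf e_n)$ satisfying, for all elements: $q(\mathsf e_i,x_1,\dots,x_n)=x_i$ for each $i$; (B1) $q(c,\mathsf e_1,\dots,\mathsf e_n)=c$; (B2) $q(c,x,\dots,x)=x$; (B3) $q(c,q(x^1_0,\dots,x^1_n),\dots,q(x^n_0,\dots,x^n_n))=q(q(c,x^1_0,\dots,x^n_0),q(c,x^1_1,\dots,x^n_1),\dots,q(c,x^1_n,\dots,x^n_n))$.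 *)

(* Defs.v *)
From HB Require Import structures.
From Corelib Require Import RelationClasses.
From mathcomp Require Import all_boot all_fingroup.
From mathcomp Require Import finmap multiset.

Set Implicit Arguments.
Unset Strict Implicit.
Unset Printing Implicit Defensive.

(* ['I_n] = {0, ..., n-1} stands for {1, ..., n} throughout. *)

Unset Elimination Schemes.
Inductive form (n : nat) (V : Type) : Type :=
| Var of V & 'S_n
| Cst of 'I_n
| Q of form n V & {ffun 'I_n -> form n V}.
Set Elimination Schemes.

Arguments Cst {n} V k.

Definition form_ind (n : nat) (V : Type) (P : form n V -> Prop)
    (PVar : forall X p, P (Var X p))
    (PCst : forall k, P (Cst V k))
    (PQ : forall F (G : {ffun 'I_n -> form n V}),
        P F -> (forall j, P (G j)) -> P (Q F G)) :=
  fix loop F : P F :=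
    match F with
    | Var X p => PVar X p
    | Cst k => PCst k
    | Q F G => PQ F G (loop F) (fun j => loop (G j))
    end.

(* A countable-type structure on formulas, needed to form [{mset form n V}]. *)
Section FormCountable.
Variables (n : nat) (V : Type).

Fixpoint form_encode (F : form n V) : GenTree.tree (V * 'S_n + 'I_n) :=
  match F with
  | Var X p => GenTree.Leaf (inl (X, p))
  | Cst k => GenTree.Leaf (inr k)
  | Q F G => GenTree.Node 0
      (form_encode F :: [seq form_encode (G j) | j <- enum 'I_n])
  end.

Fixpoint form_decode (t : GenTree.tree (V * 'S_n + 'I_n)) :
    option (form n V) :=
  match t with
  | GenTree.Leaf (inl (X, p)) => Some (Var X p)
  | GenTree.Leaf (inr k) => Some (Cst V k)
  | GenTree.Node _ (t :: ts) =>
      if form_decode t is Some F then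
        Some (Q F [ffun j : 'I_n =>
                     odflt F (nth None [seq form_decode u | u <- ts] j)])
      else None
  | _ => None
  end.

Lemma form_encodeK : pcancel form_encode form_decode.
Proof.
elim=> [X p|k|F G /= -> IHG] //=; congr (Some (Q F _)).
apply/ffunP => j; rewrite ffunE -map_comp.
rewrite (nth_map j) ?size_enum_ord ?ltn_ord //= nth_ord_enum.
by rewrite IHG.
Qed.

End FormCountable.

HB.instance Definition _ (n : nat) (V : countType) :=
  Countable.copy (form n V) (pcan_type (@form_encodeK n V)).

(* F^rho.  The product of permutations in 'S_n is diagrammatic,
   [(p * rho) x = rho (p x)], so [(p * rho)%g] is the composite rho \o p. *)
Fixpoint relabel (n : nat) (V : Type) (rho : 'S_n) (F : form n V) : form n V :=
  match F with
  | Var X p => Var X (p * rho)%g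
  | Cst k => Cst V (rho k)
  | Q F G => Q F [ffun j => relabel rho (G j)]
  end.

Local Open Scope mset_scope.

Definition crelabel (n : nat) (V : countType) (rho : 'S_n)
    (Gamma : {mset form n V}) : {mset form n V} :=
  seq_mset [seq relabel rho F | F <- Gamma].

(* [provable i Gamma Delta] is the provability of Gamma |-_i Delta.  The
   transposition (ij) is [tperm i j], which is the identity when i = j. *)
Inductive provable (n : nat) (V : countType) :
    'I_n -> {mset form n V} -> {mset form n V} -> Prop :=
| Const i :
    provable i mset0 [mset Cst V i]
| Id X (p r : 'S_n) i :
    (p^-1)%g i = (r^-1)%g i ->
    provable i [mset Var X p] [mset Var X r]
| Sym i j Gamma Delta :
    provable i (crelabel (tperm i j) Gamma) (crelabel (tperm i j) Delta) ->
    provable j Gamma Delta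
| Neg1 i j k F Gamma Delta :
    i <> k ->
    provable i (crelabel (tperm i j) Gamma)
               (F +` crelabel (tperm i j) Delta) ->
    provable j (relabel (tperm j k) F +` Gamma) Delta
| Neg2 i j k F Gamma Delta :
    j <> k ->
    provable i (crelabel (tperm i j) Gamma)
               (F +` crelabel (tperm i j) Delta) ->
    provable j (relabel (tperm i k) F +` Gamma) Delta
| Neg3 j F Gamma Delta :
    (forall i, i <> j ->
       provable i (F +` crelabel (tperm i j) Gamma)
                  (crelabel (tperm i j) Delta)) ->
    provable j Gamma (F +` Delta)
| QL i F (G : {ffun 'I_n -> form n V}) Gamma Delta :
    (forall j,
       provable j
         (F +` (relabel (tperm j i) (G j) +` crelabel (tperm j i) Gamma))
         (crelabel (tperm j i) Delta)) ->
    provable i (Q F G +` Gamma) Delta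
| QR i F (G : {ffun 'I_n -> form n V}) Gamma Delta :
    (forall j,
       provable j
         (F +` crelabel (tperm j i) Gamma)
         (relabel (tperm j i) (G j) +` crelabel (tperm j i) Delta)) ->
    provable i Gamma (Q F G +` Delta)
| Cut i F Gamma Delta :
    provable i (F +` Gamma) Delta ->
    provable i Gamma (F +` Delta) ->
    provable i Gamma Delta
| WeakL i F Gamma Delta :
    provable i Gamma Delta -> provable i (F +` Gamma) Delta
| WeakR i F Gamma Delta :
    provable i Gamma Delta -> provable i Gamma (F +` Delta)
| ContrL i F Gamma Delta :
    provable i (F +` (F +` Gamma)) Delta -> provable i (F +` Gamma) Delta
| ContrR i F Gamma Delta :
    provable i Gamma (F +` (F +` Delta)) -> provable i Gamma (F +` Delta).

Definition lequiv (n : nat) (V : countType) (F G : form n V) : Prop :=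
  forall i : 'I_n,
    provable i [mset F] [mset G] /\ provable i [mset G] [mset F].

(* The quotient of the set of formulas by [lequiv], as its set of classes. *)
Definition lindenbaum (n : nat) (V : countType) : Type :=
  {C : form n V -> Prop | exists F, C = lequiv F}.

Definition lclass (n : nat) (V : countType) (F : form n V) : lindenbaum n V :=
  exist _ (lequiv F) (ex_intro _ F erefl).

(* In (B3), [x0 j] is x^j_0 and [x j k] is x^j_k for k in 'I_n. *)
Record boolean_like_algebra (n : nat) (A : Type)
    (q : A -> {ffun 'I_n -> A} -> A) (e : 'I_n -> A) : Prop :=
  BooleanLikeAlgebra {
    bla_proj : forall (i : 'I_n) (x : {ffun 'I_n -> A}), q (e i) x = x i;
    bla_B1 : forall c : A, q c [ffun i => e i] = c;
    bla_B2 : forall c x : A, q c [ffun=> x] = x;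
    bla_B3 : forall (c : A) (x0 : 'I_n -> A) (x : 'I_n -> {ffun 'I_n -> A}),
      q c [ffun j => q (x0 j) (x j)] =
      q (q c [ffun j => x0 j]) [ffun k => q c [ffun j => x j k]]
  }.

(* Main.v *)
Require Import Defs.
From Corelib Require Import RelationClasses.
From mathcomp Require Import all_boot all_fingroup.
From mathcomp Require Import finmap multiset boolp.

Set Implicit Arguments.
Unset Strict Implicit.
Unset Printing Implicit Defensive.

(** Read a formula as an element of [{1, ..., n}] under a valuation [v] of the
    variables: [X^pi] is [pi (v X)] and [q(F, G_1, ..., G_n)] is [G_F].  The
    calculus is sound and complete for the reading of [Gamma |-_i Delta] as
    "if every formula of Gamma has value [i], then some formula of Delta has
    value [i]": the rules (qL) and (qR) are invertible and eliminate [q], and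
    an atomic sequent without a derivation has a countermodel.  Hence [F ~ G]
    iff [F] and [G] have the same value under all valuations, and the laws of
    Boolean-like algebras hold because they hold pointwise for values. *)

Section Calculus.
Variables (n : nat) (V : countType).
Local Open Scope mset_scope.
Implicit Types (v : V -> 'I_n) (F : form n V) (i j k : 'I_n).
Implicit Types (s t : seq (form n V)) (Gamma Delta : {mset form n V}).

(** * Values, validity and soundness *)

Fixpoint eval v F : 'I_n :=
  match F with
  | Var X p => p (v X)
  | Cst k => k
  | Q F G => eval v (G (eval v F))
  end.

Lemma eval_relabel v (rho : 'S_n) F : eval v (relabel rho F) = rho (eval v F).
Proof.
elim: F => [X p|k|F G IHF IHG] //=; first by rewrite permM.
by rewrite ffunE IHG.
Qed.

(** Accounts for the changes of index in the rules: a context moved from [j] to [i] keeps its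
    meaning once relabelled by the transposition. *)
Lemma eval_relabel_tperm v i j F :
  (eval v (relabel (tperm i j) F) == i) = (eval v F == j).
Proof. by rewrite eval_relabel -[i in _ == i](tpermR i j) (inj_eq perm_inj). Qed.

Definition valid v i s t : bool :=
  all (fun F => eval v F == i) s ==> has (fun F => eval v F == i) t.

Lemma perm_mset_cons F Gamma : perm_eq (F +` Gamma) (F :: Gamma).
Proof.
by rewrite -[in X in perm_eq X](seq_mset_id Gamma) -mset_cons perm_eq_seq_mset.
Qed.

Lemma all_mset_cons P F Gamma : all P (F +` Gamma) = P F && all P Gamma.
Proof. by rewrite (perm_all _ (perm_mset_cons F Gamma)). Qed.

Lemma has_mset_cons P F Gamma : has P (F +` Gamma) = P F || has P Gamma.
Proof. by rewrite (perm_has _ (perm_mset_cons F Gamma)). Qed.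

Lemma all_mset1 P F : all P [mset F] = P F.
Proof. by rewrite enum_msetn /= andbT. Qed.

Lemma has_mset1 P F : has P [mset F] = P F.
Proof. by rewrite enum_msetn /= orbF. Qed.

Lemma all_relabel v i j s :
  all (fun F => eval v F == i) (map (relabel (tperm i j)) s) =
  all (fun F => eval v F == j) s.
Proof. by rewrite all_map; apply: eq_all => F /=; rewrite eval_relabel_tperm. Qed.

Lemma has_relabel v i j s :
  has (fun F => eval v F == i) (map (relabel (tperm i j)) s) =
  has (fun F => eval v F == j) s.
Proof. by rewrite has_map; apply: eq_has => F /=; rewrite eval_relabel_tperm. Qed.

Lemma all_crelabel v i j Gamma :
  all (fun F => eval v F == i) (crelabel (tperm i j) Gamma) =
  all (fun F => eval v F == j) Gamma.
Proof. by rewrite (perm_all _ (perm_eq_seq_mset _)) all_relabel. Qed.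

Lemma has_crelabel v i j Gamma :
  has (fun F => eval v F == i) (crelabel (tperm i j) Gamma) =
  has (fun F => eval v F == j) Gamma.
Proof. by rewrite (perm_has _ (perm_eq_seq_mset _)) has_relabel. Qed.

Lemma seq_mset0 : seq_mset [::] = mset0 :> {mset form n V}.
Proof. by rewrite -[RHS]seq_mset_id enum_mset0. Qed.

Lemma seq_mset1 F : seq_mset [:: F] = [mset F].
Proof. by rewrite mset_cons seq_mset0 msetD0. Qed.

Lemma crelabel_seq_mset (rho : 'S_n) s :
  crelabel rho (seq_mset s) = seq_mset (map (relabel rho) s).
Proof. by apply/eq_seq_msetP/perm_map/perm_eq_seq_mset. Qed.

Lemma soundness v i Gamma Delta : provable i Gamma Delta -> valid v i Gamma Delta.
Proof.
rewrite /valid.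
elim=> {i Gamma Delta} [i|X p r i Epr|i j Gamma Delta _|i j k F Gamma Delta /eqP ik _|
  i j k F Gamma Delta /eqP jk _|j F Gamma Delta _ IH|i F G Gamma Delta _ IH|
  i F G Gamma Delta _ IH|i F Gamma Delta _ + _|i F Gamma Delta _|
  i F Gamma Delta _|i F Gamma Delta _|i F Gamma Delta _];
  rewrite ?all_mset_cons ?has_mset_cons ?all_crelabel ?has_crelabel
    ?all_mset1 ?has_mset1 //=.
- by rewrite eqxx implybT.
- apply/implyP => /eqP pv; apply/eqP.
  by apply: (@perm_inj _ (r^-1)%g); rewrite permK -Epr -pv permK.
(* In (Neg1) the formula on the left is true only if [F] has value [k], so [F] is false on the right
   of the premise. *)
- move/implyP=> IH; apply/implyP => /andP[Fj sat]; have := IH sat.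
  rewrite eval_relabel_tperm in Fj.
  by rewrite (eqP Fj) eq_sym (negPf ik).
- move/implyP=> IH; apply/implyP => /andP[Fj sat]; have /orP[|//] := IH sat.
  move=> /eqP Fi; move: Fj; rewrite eval_relabel Fi tpermL eq_sym.
  by rewrite (negPf jk).
(* If [F] misses the value [j], use the premise indexed by its actual value. *)
- have [//|Fj] := eqVneq (eval v F) j; first by rewrite implybT.
  by have := IH _ (elimN eqP Fj); rewrite all_mset_cons all_crelabel has_crelabel eqxx.
(* For (qL), and likewise for (qR), the premise indexed by the value of [F] selects the right
   branch. *)
- have := IH (eval v F).
  by rewrite !all_mset_cons all_crelabel has_crelabel eval_relabel_tperm eqxx.
- have := IH (eval v F).
  by rewrite all_mset_cons has_mset_cons all_crelabel has_crelabel
    eval_relabel_tperm eqxx.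
- by move=> /implyP IH1 /implyP IH2; apply/implyP => sat;
    have /orP[Fi|//] := IH2 sat; apply: IH1; rewrite Fi.
- by move/implyP=> IH; apply/implyP => /andP[_].
- by move/implyP=> IH; apply/implyP => /IH ->; rewrite orbT.
- by rewrite andbA andbb.
- by rewrite orbA orbb.
Qed.

(** * The rules on lists of formulas *)

Definition derivable i s t := provable i (seq_mset s) (seq_mset t).

Lemma perm_derivable i s s' t t' : perm_eq s s' -> perm_eq t t' ->
  derivable i s t -> derivable i s' t'.
Proof. by rewrite /derivable => /eq_seq_msetP-> /eq_seq_msetP->. Qed.

Lemma derivable_weak i s0 t0 s t :
  derivable i s t -> derivable i (s0 ++ s) (t0 ++ t).
Proof.
move=> st; elim: s0 => [|F s0 IH] /=; last by rewrite /derivable mset_cons; apply: WeakL.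
by elim: t0 => [|F t0 IH] //=; rewrite /derivable mset_cons; apply: WeakR.
Qed.

Lemma derivable_contrL i F s t : F \in s -> derivable i (F :: s) t -> derivable i s t.
Proof.
move=> Fs; rewrite /derivable; have /eq_seq_msetP-> := perm_to_rem Fs.
rewrite !mset_cons; have /eq_seq_msetP-> := perm_to_rem Fs.
by rewrite mset_cons; apply: ContrL.
Qed.

Lemma derivable_contrR i F s t : F \in t -> derivable i s (F :: t) -> derivable i s t.
Proof.
move=> Ft; rewrite /derivable !mset_cons; have /eq_seq_msetP-> := perm_to_rem Ft.
by rewrite mset_cons; apply: ContrR.
Qed.

(** Weakening adds [s'] and [t']; contraction then absorbs the members of [s] and [t] one by one. *)
Lemma derivable_sub i s s' t t' : {subset s <= s'} -> {subset t <= t'} ->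
  derivable i s t -> derivable i s' t'.
Proof.
move=> ss tt /(derivable_weak s' t').
move/(perm_derivable (permEl (perm_catC s' s)) (permEl (perm_catC t' t))).
elim: s ss => [_|F s IH ss] /=.
  elim: t tt => [_|F t IH tt] //= d; apply: IH => [G Gt|].
    by apply: tt; rewrite inE Gt orbT.
  by apply: derivable_contrR d; rewrite mem_cat (tt F) ?mem_head ?orbT.
move=> d; apply: IH => [G Gs|]; first by apply: ss; rewrite inE Gs orbT.
by apply: derivable_contrL d; rewrite mem_cat (ss F) ?mem_head ?orbT.
Qed.

Lemma derivable_suball i s' t' s t : derivable i s t ->
  all (mem s') s -> all (mem t') t -> derivable i s' t'.
Proof. by move=> d /allP ss /allP tt; apply: derivable_sub d. Qed.

Lemma relabel1 F : relabel 1%g F = F.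
Proof.
elim: F => [X p|k|F G IHF IHG] /=; rewrite ?mulg1 ?perm1 //.
by congr Q; apply/ffunP => j; rewrite ffunE.
Qed.

(** The instance of (Neg1) with equal indices, where contexts are relabelled by the identity. *)
Lemma derivable_Neg1 i k F s t : i <> k ->
  derivable i s (F :: t) -> derivable i (relabel (tperm i k) F :: s) t.
Proof.
move=> ik; rewrite /derivable !mset_cons => d; apply: (@Neg1 _ _ i) => //.
by rewrite tperm1 !crelabel_seq_mset !(eq_map relabel1) !map_id.
Qed.

Lemma derivable_Neg3 j F s t :
  (forall i, i <> j ->
     derivable i (F :: map (relabel (tperm i j)) s) (map (relabel (tperm i j)) t)) ->
  derivable j s (F :: t).
Proof.
move=> d; rewrite /derivable mset_cons; apply: Neg3 => i /d.
by rewrite /derivable mset_cons !crelabel_seq_mset.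
Qed.

Lemma derivable_QL i F (G : {ffun 'I_n -> form n V}) s t :
  (forall j, derivable j
     (F :: relabel (tperm j i) (G j) :: map (relabel (tperm j i)) s)
     (map (relabel (tperm j i)) t)) ->
  derivable i (Q F G :: s) t.
Proof.
move=> d; rewrite /derivable mset_cons; apply: QL => j; have := d j.
by rewrite /derivable !mset_cons !crelabel_seq_mset.
Qed.

Lemma derivable_QR i F (G : {ffun 'I_n -> form n V}) s t :
  (forall j, derivable j
     (F :: map (relabel (tperm j i)) s)
     (relabel (tperm j i) (G j) :: map (relabel (tperm j i)) t)) ->
  derivable i s (Q F G :: t).
Proof.
move=> d; rewrite /derivable mset_cons; apply: QR => j; have := d j.
by rewrite /derivable !mset_cons !crelabel_seq_mset.
Qed.

(** * Derivations and countermodels of atomic sequents *)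

Lemma derivable_Const i : derivable i [::] [:: Cst V i].
Proof. by rewrite /derivable seq_mset0 seq_mset1; apply: Const. Qed.

Lemma derivable_Id i X (p r : 'S_n) : (p^-1)%g i = (r^-1)%g i ->
  derivable i [:: Var X p] [:: Var X r].
Proof. by rewrite /derivable !seq_mset1; apply: Id. Qed.

Lemma derivable_const_neq i k : k != i -> derivable i [:: Cst V k] [::].
Proof.
move=> /eqP ki; apply: (@perm_derivable i [:: relabel (tperm i k) (Cst V i)] _ [::]) => //.
  by rewrite /= tpermL.
by apply: derivable_Neg1 (derivable_Const i) => /esym.
Qed.

Lemma derivable_var_neq i X (p r : 'S_n) : (p^-1)%g i <> (r^-1)%g i ->
  derivable i [:: Var X p; Var X r] [::].
Proof.
move=> pr; pose k := r ((p^-1)%g i).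
have ik : i <> k by move=> ik; apply: pr; rewrite {2}ik permK.
apply: (@perm_derivable i [:: Var X r; Var X p] _ [::]) => //.
  exact: (permEl (perm_catC [:: Var X r] _)).
have := @derivable_Neg1 i k (Var X (r * tperm i k)%g) [:: Var X p] [::] ik.
rewrite /= -mulgA tperm2 mulg1; apply; apply: derivable_Id.
by rewrite invMg permM tpermV tpermL /k permK.
Qed.

(* Under a reading at index [i], [Var X p] asserts that [X] has value
   [p^-1 i]. *)
Definition asserts i X a F : bool :=
  if F is Var Y p then (Y == X) && ((p^-1)%g i == a) else false.

(** (Neg3) moves a copy of some [X^r] in [t] to the left at each other index [k], where it says that
    [X] has value [r^-1 k]; some member of [t] asserts just this. *)
Lemma derivable_var_all i X t : (forall a, has (asserts i X a) t) -> derivable i [::] t.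
Proof.
move=> Xt.
have {}Xt a : exists2 p : 'S_n, Var X p \in t & (p^-1)%g i = a.
  by have /hasP[[Y p|k|F G] // Ft /andP[/eqP <- /eqP]] := Xt a; exists p.
have [r rt _] := Xt i; apply: (derivable_contrR rt).
apply: derivable_Neg3 => k ki /=.
have [p pt pi] := Xt ((r^-1)%g k).
apply: (@derivable_suball k _ _ [:: Var X r] [:: Var X (p * tperm k i)%g]).
- by apply: derivable_Id; rewrite invMg permM tpermV tpermL pi.
- by rewrite /= mem_head.
- by rewrite /= andbT; apply/mapP; exists (Var X p).
Qed.

Definition is_compound F := if F is Q _ _ then true else false.

(** Validity is applied to a single valuation: a formula of [t] true under it, or one of [s] false
    under it, leads to a derivation. *)
Lemma completeness_atomic i s t : ~~ has is_compound s -> ~~ has is_compound t ->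
  (forall v, valid v i s t) -> derivable i s t.
Proof.
move=> /hasPn s_at /hasPn t_at st.
(* The countermodel: obey the left side, avoid the values named on the right. *)
pose v X := if [pick a | has (asserts i X a) s] is Some a then a
            else odflt i [pick a | ~~ has (asserts i X a) t].
have v_left X p : Var X p \in s -> derivable i s t \/ v X = (p^-1)%g i.
  move=> Xs; rewrite /v; case: pickP => [a|/(_ ((p^-1)%g i))/hasP[]]; last first.
    by exists (Var X p) => //=; rewrite !eqxx.
  case/hasP=> -[Y r|//|//] Ys /andP[/eqP EY /eqP <-]; rewrite {Y}EY in Ys.
  (* Two members of [s] asserting different values of [X] contradict each other. *)
  have [->|/eqP pr] := eqVneq ((r^-1)%g i) ((p^-1)%g i); [by right|left].
  by apply: derivable_suball (derivable_var_neq X pr) _ _; rewrite //= Ys Xs.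
have v_right X p : Var X p \in t -> v X = (p^-1)%g i -> derivable i s t.
  move=> Xt; rewrite /v; case: pickP => [a /hasP[[Y r|//|//] Ys]|_].
    move=> /andP[/eqP EY /eqP <-] rp; rewrite {Y}EY in Ys.
    apply: (@derivable_suball i _ _ [:: Var X r] [:: Var X p]); rewrite /= ?andbT //.
    exact: derivable_Id.
  case: pickP => [a /= /negP nt ap|all_t _].
    by case: nt; apply/hasP; exists (Var X p); rewrite //= eqxx ap eqxx.
  (* Here [t] names every value of [X], the case in which [v] takes its default. *)
  apply: (@derivable_sub i [::] _ t) => //; apply: (@derivable_var_all i X) => a.
  by have /negbFE := all_t a.
have [/hasP[F Ft /eqP Fi]|] := boolP (has (fun F => eval v F == i) t).
  case: F Ft Fi (t_at F Ft) => [X p|k|//] Ft /= Fi _.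
    by apply: v_right Ft _; rewrite -Fi permK.
  rewrite {k}Fi in Ft.
  apply: (@derivable_suball i _ _ [::] [:: Cst V i]); rewrite /= ?andbT //.
  exact: derivable_Const.
move=> nt; have := st v; rewrite /valid (negPf nt) implybF.
case/allPn=> F Fs /eqP Fi; case: F Fs Fi (s_at F Fs) => [X p|k|//] Fs /= Fi _.
  by have [//|vX] := v_left X p Fs; case: Fi; rewrite vX permKV.
by apply: derivable_suball (derivable_const_neq (introN eqP Fi)) _ _; rewrite //= Fs.
Qed.

(** * Elimination of [q] and completeness *)

Fixpoint fsize F : nat :=
  if F is Q F G then (fsize F + \sum_j fsize (G j)).+1 else 0.

Lemma fsize_relabel (rho : 'S_n) F : fsize (relabel rho F) = fsize F.
Proof.
elim: F => [X p|k|F G IHF IHG] //=; congr (_ + _).+1.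
by apply: eq_bigr => j _; rewrite ffunE IHG.
Qed.

Definition ssize s := \sum_(F <- s) fsize F.

Lemma ssize_relabel (rho : 'S_n) s : ssize (map (relabel rho) s) = ssize s.
Proof. by rewrite /ssize big_map; apply: eq_bigr => F _; apply: fsize_relabel. Qed.

Lemma ssize_cons F s : ssize (F :: s) = fsize F + ssize s.
Proof. exact: big_cons. Qed.

Lemma fsize_Q F (G : {ffun 'I_n -> form n V}) j : fsize F + fsize (G j) < fsize (Q F G).
Proof. by rewrite /= ltnS leq_add2l (bigD1 j) //= leq_addr. Qed.

Lemma valid_perm v i s s' t t' : perm_eq s s' -> perm_eq t t' ->
  valid v i s t = valid v i s' t'.
Proof. by move=> ss tt; rewrite /valid (perm_all _ ss) (perm_has _ tt). Qed.

(** Induction on the total size: (qL) and (qR), read upwards, trade [Q F G] for the smaller pair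
    [F], [G j] and preserve validity, down to atomic sequents. *)
Lemma completeness i s t : (forall v, valid v i s t) -> derivable i s t.
Proof.
have [m] := ubnP (ssize s + ssize t); elim: m => // m IH in i s t * => lt_m st.
have [/hasP[[//|//|F G] Fs _]|s_at] := boolP (has is_compound s).
  have Es := perm_to_rem Fs; set s' := rem _ s in Es.
  have Em : ssize s = fsize (Q F G) + ssize s'.
    by rewrite -ssize_cons; apply: perm_big.
  apply: (@perm_derivable i (Q F G :: s') _ t) => //; first by rewrite perm_sym.
  apply: derivable_QL => j; apply: IH => [|v].
    rewrite !ssize_cons !ssize_relabel fsize_relabel.
    rewrite Em in lt_m; have := fsize_Q F G j; move: lt_m; move: (fsize (Q F G)) => a.
    rewrite !ltnS => le_m lt_a; apply: leq_trans le_m.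
    by rewrite addnA -addSn leq_add2r -addSn leq_add2r.
  have := st v; rewrite (valid_perm _ _ Es (perm_refl t)) /valid /=.
  rewrite all_relabel has_relabel eval_relabel_tperm.
  (* If [F] has value [j], the premise says the same as the conclusion; otherwise its left side is
     false. *)
  by have [->|] := eqVneq (eval v F) j.
have [/hasP[[//|//|F G] Ft _]|t_at] := boolP (has is_compound t); last first.
  exact: completeness_atomic.
have Et := perm_to_rem Ft; set t' := rem _ t in Et.
have Em : ssize t = fsize (Q F G) + ssize t'.
  by rewrite -ssize_cons; apply: perm_big.
apply: (@perm_derivable i s _ (Q F G :: t')) => //; first by rewrite perm_sym.
apply: derivable_QR => j; apply: IH => [|v].
  rewrite !ssize_cons !ssize_relabel fsize_relabel.
  rewrite Em addnCA in lt_m; have := fsize_Q F G j; move: lt_m; move: (fsize (Q F G)) => a.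
  rewrite !ltnS => le_m lt_a; apply: leq_trans le_m.
  by rewrite addnACA -addSn leq_add2r.
have := st v; rewrite (valid_perm _ _ (perm_refl s) Et) /valid /=.
rewrite all_relabel has_relabel eval_relabel_tperm.
by have [->|] := eqVneq (eval v F) j.
Qed.

(** * The quotient and its operation *)

Lemma lequivP F G : lequiv F G <-> forall v, eval v F = eval v G.
Proof.
split=> [FG v|FG i].
  (* At this index the left side is true under [v]. *)
  have [/(soundness v) + _] := FG (eval v F).
  by rewrite /valid all_mset1 has_mset1 eqxx => /eqP.
rewrite -!seq_mset1.
by split; apply: completeness => v; rewrite /valid /= FG andbT orbF implybb.
Qed.

(** Classes are predicates: extensionality identifies them, and evaluating equal ones at [G] reduces
    the converse to reflexivity. *)
Lemma lclassP F G : lclass F = lclass G <-> lequiv F G.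
Proof.
split=> [[]|/lequivP FG].
  by move/(congr1 (fun C => C G)) => ->; apply/lequivP.
apply: eq_exist; apply/funext => H; apply/propext.
by split=> /lequivP E; apply/lequivP => v; rewrite -E FG.
Qed.

Definition repr (C : lindenbaum n V) : form n V := projT1 (cid (projT2 C)).

Lemma reprK C : lclass (repr C) = C.
Proof. by case: C => C C_; apply: eq_exist; rewrite /repr; case: cid. Qed.

Lemma eval_repr v F : eval v (repr (lclass F)) = eval v F.
Proof. by move: v; apply/lequivP/lclassP/reprK. Qed.

(** The choice of representatives is harmless, since the value of a compound depends only on the
    values of its parts. *)
Definition lindenbaum_q (C : lindenbaum n V) (D : {ffun 'I_n -> lindenbaum n V}) :=
  lclass (Q (repr C) [ffun j => repr (D j)]).

Lemma lclass_eq F G : (forall v, eval v F = eval v G) -> lclass F = lclass G.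
Proof. by move=> FG; apply/lclassP/lequivP. Qed.

End Calculus.

Theorem theorem4p6 (n : nat) (n_ge2 : 2 <= n) (V : countType) :
  Equivalence (@lequiv n V) /\
  exists q : lindenbaum n V -> {ffun 'I_n -> lindenbaum n V} -> lindenbaum n V,
    (forall (F : form n V) (G : {ffun 'I_n -> form n V}),
       q (lclass F) [ffun j => lclass (G j)] = lclass (Q F G)) /\
    boolean_like_algebra q (fun k : 'I_n => lclass (Cst V k)).
Proof.
split.
  split=> [F|F G /lequivP FG|F G H /lequivP FG /lequivP GH]; apply/lequivP => v //.
  by rewrite FG.
exists (@lindenbaum_q n V); split=> [F G|].
  by apply: lclass_eq => v /=; rewrite !ffunE !eval_repr.
split=> [i x|c|c x|c x0 x]; rewrite /lindenbaum_q.
(* The bare class on the right becomes the class of its representative, so that values can be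
   compared. *)
- by rewrite -[RHS]reprK; apply: lclass_eq => v /=; rewrite !ffunE eval_repr.
- by rewrite -[RHS]reprK; apply: lclass_eq => v /=; rewrite !ffunE eval_repr.
- by rewrite -[RHS]reprK; apply: lclass_eq => v /=; rewrite !ffunE.
(* With [a] the value of [c] and [b] that of [x0 a], both sides have the value of [x a b]. *)
- by apply: lclass_eq => v /=; do 3?rewrite !(ffunE, eval_repr) /=.
Qed.
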